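(* Let $d>1$ be a square-free integer, let $K=\mathbb{Q}(\sqrt{d})$ with ring of integers $\mathcal{O}_K$, and let $\ell$ be a square-free positive integer. There exists an Arakelov-modular lattice of level $\ell$ of trace type over $K$ if and only if $\ell=d$. Moreover, $(I,1)$, where \[ I=\begin{cases}\mathfrak{P}_2^{-1} & d\equiv 2,3 \pmod 4,\\ \mathcal{O}_K & d\equiv 1\pmod 4,\end{cases} \] is an Arakelov-modular lattice of level $d$. Here, for $d\equiv 2,3\pmod 4$, $\mathfrak{P}_2$ is the unique prime ideal of $\mathcal{O}_K$ above $2$.
   Context: An element $\alpha\in K^\times$ is totally positive if $\sigma(\alpha)>0$ for every embedding $\sigma:K\to\mathbb{R}$. An ideal lattice over the totally real field $K$ is a pair $(I,\alpha)$, where $I$ is a (nonzero) fractional $\mathcal{O}_K$-ideal, $\alpha\in K^\times$ is totally positive, and $I$ carries the positive definite symmetric bilinear form $b_\alpha(x,y)=\mathrm{Tr}_{K/\mathbb{Q}}(\alpha xy)$. Its dual is $(I^*,\alpha)$ with $I^*=\alpha^{-1}\mathcal{D}_K^{-1}I^{-1}=\{x\in K: b_\alpha(x,y)\in\mathbb{Z}\ \forall y\in I\}$, where $\mathcal{D}_K$ is the different of $K/\mathbb{Q}$. For a positive integer $\ell$, $(I,\alpha)$ is Arakelov-modular of level $\ell$ if there exists $\beta\in K^\times$ such that $I=\beta I^*$ and $\ell=\beta^2$. It is of trace type if $\alpha=1$. *)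

(* Defs.v *)
From HB Require Import structures.
From mathcomp Require Import all_boot all_order all_algebra all_field.
From mathcomp Require Import classical_sets reals.

Set Implicit Arguments.
Unset Strict Implicit.
Unset Printing Implicit Defensive.

Import Order.TTheory GRing.Theory Num.Theory.

Local Open Scope classical_set_scope.
Local Open Scope ring_scope.

Definition squarefree (n : nat) : Prop :=
  forall m : nat, (m ^ 2 %| n)%N -> m = 1%N.

Section NumberField.

Variable K : fieldExtType rat.

(* Number fields are types [K : fieldExtType rat]; the ring of integers,
   ideals and lattices are subsets of the carrier of K. *)

Definition ring_of_integers : set K :=
  [set x | integralOver (intr : int -> K) x].

(* Tr_{K/Q}(x) is the trace of the Q-linear map y |-> x * y; [vbasis] is an
   arbitrary Q-basis of K. *)
Definition field_trace (x : K) : rat :=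
  \tr (passmx.mxof (vbasis {:K}) (vbasis {:K}) (amull x)).

Definition OK_submodule (I : set K) : Prop :=
  [/\ I 0,
      forall x y, I x -> I y -> I (x + y)
    & forall a x, ring_of_integers a -> I x -> I (a * x)].

Definition fractional_ideal (I : set K) : Prop :=
  [/\ OK_submodule I,
      exists2 x, I x & x != 0
    & exists c, [/\ ring_of_integers c, c != 0
                  & forall x, I x -> ring_of_integers (c * x)]].

Definition prime_ideal (P : set K) : Prop :=
  [/\ P `<=` ring_of_integers, OK_submodule P, ~ P 1
    & forall x y, ring_of_integers x -> ring_of_integers y ->
        P (x * y) -> P x \/ P y].

(* P is a prime ideal of O_K with P \cap Z = p Z. *)
Definition prime_lying_above (p : nat) (P : set K) : Prop :=
  prime_ideal P /\ forall n : int, P (n%:~R) <-> (p %| n)%Z.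

Definition ideal_inv (I : set K) : set K :=
  [set x | forall y, I y -> ring_of_integers (x * y)].

Definition totally_positive (R : realType) (a : K) : Prop :=
  a != 0 /\ forall sigma : {rmorphism K -> R}, 0 < sigma a.

(* The symmetric bilinear form b_a carried by the ideal lattice (I, a). *)
Definition lattice_form (a x y : K) : rat := field_trace (a * x * y).

Definition ideal_lattice (R : realType) (I : set K) (a : K) : Prop :=
  fractional_ideal I /\ totally_positive R a.

(* The ideal I^* underlying the dual of (I, a). *)
Definition dual_ideal (I : set K) (a : K) : set K :=
  [set x | forall y, I y -> lattice_form a x y \is a Num.int].

Definition arakelov_modular (R : realType) (l : nat) (I : set K) (a : K) :
    Prop :=
  ideal_lattice R I a /\
  exists b : K, [/\ b != 0,
                    I = [set b * x | x in dual_ideal I a]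
                  & l%:R = b ^+ 2].

Definition trace_type (a : K) : Prop := a = 1.

End NumberField.

Arguments ring_of_integers K : clear implicits.

(* Main.v *)
Require Import Defs.
From HB Require Import structures.
From mathcomp Require Import all_boot all_order all_algebra all_field.
From mathcomp Require Import boolp classical_sets reals.
From mathcomp Require Import zify ring lra.

Set Implicit Arguments.
Unset Strict Implicit.
Unset Printing Implicit Defensive.

Import Order.TTheory GRing.Theory Num.Theory passmx.

Local Open Scope classical_set_scope.
Local Open Scope ring_scope.

(** Write s for the given square root of d. Since d > 1 is square-free, s is
    irrational, (1, s) is a rational basis of K, and the trace of a + b s
    is 2a (field_traceE).

    Level: from l = b ^ 2 with b in K, comparing coordinates gives that l is a
    rational square or d times one, so l = 1 or l = d because both are
    square-free. If l = 1 then b is 1 or -1, hence I would be equal to its own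
    dual. This cannot happen: an ideal is a lattice of rank 2, and the
    determinant of the trace form on any lattice of K is 4 d (the determinant in
    the basis (1, s)) times a rational square, whereas a self-dual lattice
    has determinant 1; then d would be a rational square (not_self_dual).

    Existence: the lattice L of the x = a + b s such that 2b and a + d b are
    integers satisfies L = s L^* for every d (half_lattice_modular), because
    the pairing of x / s with y is twice the s-coordinate of x y. When
    d = 1 mod 4, the lattice L is the ring of integers
    (ring_of_integers_1mod4). When d = 2 or 3 mod 4, the ring of integers is
    Z[s], sending s to d mod 2 defines a ring morphism onto the field with two
    elements, its kernel P2 is the only prime above 2 since the square of each
    of its elements is divisible by 2 (prime_two_unique), and L is the inverse
    of P2 (prime_two_inv). *)

(** * Square-free integers and subgroups of the rationals *)

(** The square of the denominator of q is coprime to that of the numerator, so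
    it divides n. *)
Lemma squarefree_rat_int (n : nat) (q : rat) :
  squarefree n -> n%:R * q ^+ 2 \is a Num.int -> q \is a Num.int.
Proof.
move=> sqn /intrP[z qz]; rewrite Qint_def.
have den0 : (denq q)%:~R != 0 :> rat by rewrite intr_eq0 denq_neq0.
have eqz : n%:Z * numq q ^+ 2 = z * denq q ^+ 2.
  apply: (@intr_inj rat).
  rewrite [LHS]rmorphM [RHS]rmorphM !rmorphXn /= -pmulrn -qz.
  by rewrite -{2}[q]divq_num_den; field.
have : (`|denq q| ^ 2 %| n)%N.
  rewrite -(@Gauss_dvdl _ _ (`|numq q| ^ 2)); last first.
    by rewrite coprimeXl // coprimeXr // coprime_sym coprime_num_den.
  by rewrite -!abszX -[n]/(`|n%:Z|%N) -abszM eqz abszM dvdn_mull.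
by move/sqn => den1; rewrite -absz_denq den1.
Qed.

Lemma squarefree_ratsq_eq (m n : nat) (q : rat) :
  squarefree m -> squarefree n -> m%:R = n%:R * q ^+ 2 -> m = n.
Proof.
move=> sqm sqn mq.
have /intrP[z qz] : q \is a Num.int.
  by apply: (squarefree_rat_int sqn); rewrite -mq rpred_nat.
have eqm : m = (n * `|z| ^ 2)%N.
  have : m%:Z = n%:Z * z ^+ 2.
    by apply: (@intr_inj rat); rewrite rmorphM rmorphXn /= -!pmulrn mq qz.
  by move/(congr1 absz); rewrite abszM abszX.
have : (`|z| ^ 2 %| m)%N by rewrite eqm dvdn_mull.
by move/sqm=> z1; rewrite eqm z1 muln1.
Qed.

Lemma squarefree1 : squarefree 1.
Proof. by move=> m; rewrite dvdn1 => /eqP; case: m => [|[|m]] //; lia. Qed.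

Lemma int_parity (m : int) : exists a, m = 2 * a \/ m = 2 * a + 1.
Proof.
exists (m %/ 2)%Z; have := divz_eq m 2.
by have := @modz_ge0 m 2 isT; have := @ltz_pmod m 2 isT; lia.
Qed.

(** A generator is an element a for which the absolute value of the integer N a
    is positive and minimal: Euclidean division by N a then produces smaller
    elements, hence zero. *)
Lemma cyclic_rat_subgroup (G : set rat) (N g : rat) :
  (forall x y, G x -> G y -> G (x - y)) ->
  (forall x, G x -> N * x \is a Num.int) -> N != 0 -> G g -> g != 0 ->
  exists a, [/\ a != 0, G a & forall x, G x -> exists k : int, x = k%:~R * a].
Proof.
move=> GB GN N0 Gg g0.
have G0 : G 0 by rewrite -(subrr g); apply: GB.
have GD x y : G x -> G y -> G (x + y).
  by move=> Gx Gy; rewrite -[y]opprK -[- y]sub0r; apply/GB/GB.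
have GZ (k : int) x : G x -> G (k%:~R * x).
  move=> Gx; have Gn (n : nat) : G (n%:R * x).
    by elim: n => [|n IHn]; rewrite ?mul0r // -natr1 mulrDl mul1r; apply: GD.
  case: k => n; first exact: Gn.
  by rewrite NegzE rmorphN mulNr -sub0r; apply: GB => //; apply: Gn.
pose P n :=
  `[< exists a (z : int), [/\ G a, a != 0, N * a = z%:~R & `|z|%N = n] >].
have exP : exists n, P n.
  by have /intrP[z Ngz] := GN g Gg; exists `|z|%N; apply/asboolP; exists g, z.
case: (ex_minnP exP) => _ /asboolP[a [z [Ga a0 Naz <-]]] minP.
have z0 : z != 0 by rewrite -(intr_eq0 rat) -Naz mulf_neq0.
exists a; split=> // x Gx; have /intrP[w Nxw] := GN x Gx.
exists (w %/ z)%Z; apply/eqP; rewrite -subr_eq0; apply: contraT => r0.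
have: P `|(w %% z)%Z|%N.
  apply/asboolP; exists (x - (w %/ z)%Z%:~R * a), (w %% z)%Z; split=> //.
    by apply/GB/GZ.
  rewrite mulrBr mulrCA Naz Nxw {1}(divz_eq w z) rmorphD rmorphM /=; ring.
move/minP; rewrite leqNgt -ltz_nat !abszE ger0_norm ?modz_ge0 //.
by rewrite ltz_mod.
Qed.

(** * Integers and ideals of a number field *)

(** Transported to the algebraic numbers, this is the statement that rational
    algebraic integers are integers. *)
Lemma integral_rat_int (K : fieldExtType rat) (a : rat) :
  ring_of_integers K a%:A -> a \is a Num.int.
Proof.
case=> p mon_p.
have -> : map_poly intr p = map_poly (in_alg K) (map_poly intr p).
  rewrite -map_poly_comp; apply: eq_map_poly => z.
  by rewrite [RHS](rmorph_int (in_alg K)).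
rewrite -in_algE fmorph_root => pa0.
have /intrP[z az] : ratr a \is a @Num.int algC.
  apply: Cint_rat_Aint; first exact: Crat_rat.
  apply: (@root_monic_Aint (map_poly ratr (map_poly intr p))).
  - by rewrite fmorph_root.
  - by rewrite !map_monic ?monic_map.
  rewrite -map_poly_comp; apply/polyOverP=> i; rewrite coef_map /=.
  by rewrite ratr_int rpred_int.
apply/intrP; exists z; apply: (fmorph_inj (ratr : rat -> algC)).
by rewrite [RHS]ratr_int -az.
Qed.

Lemma OK_submodule_ring (K : fieldExtType rat) :
  OK_submodule (ring_of_integers K).
Proof.
split; [exact: integral0 | by move=> x y; apply: integral_add |].
by move=> x y; apply: integral_mul.
Qed.

Lemma fractional_ideal_ring (K : fieldExtType rat) :
  fractional_ideal (ring_of_integers K).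
Proof.
have O1 : ring_of_integers K 1 by apply: integral1.
split; [exact: OK_submodule_ring | by exists 1; rewrite ?oner_neq0 |].
by exists 1; split; rewrite ?oner_neq0 // => x; rewrite mul1r.
Qed.

Lemma fractional_ideal_inv (K : fieldExtType rat) (I : set K) (c : K) :
  I `<=` ring_of_integers K -> I c -> c != 0 -> fractional_ideal (ideal_inv I).
Proof.
move=> IO Ic c0; split.
- split=> [y _|x y Ix Iy z Iz|a x Oa Ix y Iy].
  + by rewrite mul0r; apply: integral0.
  + by rewrite mulrDl; apply: integral_add; [apply: Ix | apply: Iy].
  + by rewrite -mulrA; apply: integral_mul => //; apply: Ix.
- by exists 1; rewrite ?oner_neq0 // => y Iy; rewrite mul1r; apply: IO.
by exists c; split=> // [|x Ix]; [apply: IO | rewrite mulrC; apply: Ix].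
Qed.

(** * Coordinates and trace in a real quadratic field *)

Section QuadraticField.

Variables (d : nat) (K : fieldExtType rat) (s : K).
Hypotheses (hd1 : (1 < d)%N) (hd : squarefree d).
Hypotheses (hs : s ^+ 2 = d%:R) (hK : <<1; s>>%VS = {:K}%VS).

Let dQ : rat := d%:R.

Lemma sqrt_nrat (a : rat) : s <> a%:A.
Proof.
move=> sa; have : dQ = 1%:R * a ^+ 2.
  have := hs; rewrite sa -!in_algE -rmorphXn /= -(rmorph_nat (in_alg K)).
  by move/(fmorph_inj (in_alg K)); rewrite /dQ => <-; rewrite mul1r.
by move/(squarefree_ratsq_eq hd squarefree1) => d1; move: hd1; rewrite d1.
Qed.

Lemma sqrt_neq0 : s != 0.
Proof. by apply/eqP=> s0; apply: (@sqrt_nrat 0); rewrite s0 scale0r. Qed.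

Definition qbasis : 2.-tuple K := [tuple 1; s].

Lemma qbasis_free : free qbasis.
Proof.
rewrite /= free_cons span_seq1 /free /= span_seq1 dim_vline.
rewrite sqrt_neq0 eqxx andbT; apply/vlineP=> -[k k1].
have k0 : k != 0.
  by apply: contra_eq_neq k1 => ->; rewrite scale0r oner_eq0.
by apply: (@sqrt_nrat k^-1); rewrite k1 scalerA mulVf // scale1r.
Qed.

(** The span of 1 and s is stable under multiplication by s, so it contains
    all the polynomial expressions in s. *)
Lemma qbasis_full : <<qbasis>>%VS = {:K}%VS.
Proof.
apply/eqP; rewrite eqEsubv subvf /= -hK; apply/subvP => _ /Fadjoin1_polyP[p ->].
have spanE : <<qbasis>>%VS = (<[1]> + <[s]>)%VS by rewrite span_cons span_seq1.
have V1 : 1 \in <<qbasis>>%VS by apply: memv_span; rewrite !inE eqxx.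
have Vs : s \in <<qbasis>>%VS by apply: memv_span; rewrite !inE eqxx orbT.
elim/poly_ind: p => [|p c]; first by rewrite map_poly0 horner0 mem0v.
rewrite rmorphD rmorphM /= map_polyX map_polyC /= hornerMXaddC {1}spanE.
move=> /memv_addP[_ /vlineP[a ->] [_ /vlineP[b ->] ->]].
rewrite memvD ?memvZ // mulrDl -!scalerAl mul1r -expr2 hs memvD ?memvZ //.
by rewrite -scaler_nat memvZ.
Qed.

Lemma qbasis_basis : basis_of {:K} qbasis.
Proof.
by apply/andP; split; [rewrite qbasis_full | exact: qbasis_free].
Qed.

(** The coordinates in the basis (1, s); the names recall the case of the
    complex numbers. *)
Definition re (x : K) : rat := coord qbasis ord0 x.
Definition im (x : K) : rat := coord qbasis ord_max x.
Definition mkq (a b : rat) : K := a%:A + b *: s.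

Lemma mkq_eta x : x = mkq (re x) (im x).
Proof.
rewrite [LHS](coord_basis qbasis_basis (memvf x)).
rewrite !big_ord_recl big_ord0 addr0.
by congr (_ + coord _ _ _ *: _); apply: val_inj.
Qed.

Lemma re_mkq a b : re (mkq a b) = a.
Proof.
have -> : mkq a b = \sum_i (if i == ord0 :> 'I_2 then a else b) *: qbasis`_i.
  by rewrite !big_ord_recl big_ord0 addr0.
by rewrite /re coord_sum_free ?qbasis_free.
Qed.

Lemma im_mkq a b : im (mkq a b) = b.
Proof.
have -> : mkq a b = \sum_i (if i == ord0 :> 'I_2 then a else b) *: qbasis`_i.
  by rewrite !big_ord_recl big_ord0 addr0.
by rewrite /im coord_sum_free ?qbasis_free.
Qed.

Lemma mkqM a b a' b' :
  mkq a b * mkq a' b' = mkq (a * a' + dQ * b * b') (a * b' + b * a').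
Proof.
have mkqE u v : mkq u v = in_alg K u + in_alg K v * s.
  by rewrite /mkq -[v *: s]mulr_algl.
have dE : in_alg K dQ = s ^+ 2 by rewrite hs rmorph_nat.
by rewrite !mkqE; ring: dE.
Qed.

Lemma mkqD a b a' b' : mkq a b + mkq a' b' = mkq (a + a') (b + b').
Proof. by rewrite /mkq !scalerDl addrACA. Qed.

Lemma mkqZ c a b : c *: mkq a b = mkq (c * a) (c * b).
Proof. by rewrite /mkq scalerDr !scalerA. Qed.

Lemma mkqN a b : - mkq a b = mkq (- a) (- b).
Proof. by rewrite /mkq !scaleNr opprD. Qed.

Lemma mkq_rat a : a%:A = mkq a 0.
Proof. by rewrite /mkq scale0r addr0. Qed.

Lemma mkq_int (z : int) : z%:~R = mkq z%:~R 0.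
Proof. by rewrite -mkq_rat -in_algE rmorph_int. Qed.

Lemma mkq1 : 1 = mkq 1 0. Proof. by rewrite -mkq_rat scale1r. Qed.

Lemma reM x y : re (x * y) = re x * re y + dQ * im x * im y.
Proof. by rewrite {1}[x]mkq_eta {1}[y]mkq_eta mkqM re_mkq. Qed.

Lemma imM x y : im (x * y) = re x * im y + im x * re y.
Proof. by rewrite {1}[x]mkq_eta {1}[y]mkq_eta mkqM im_mkq. Qed.

Lemma mkq0 : mkq 0 0 = 0. Proof. by rewrite /mkq !scale0r addr0. Qed.
Lemma mkq2 : 2 = mkq 2%:~R 0. Proof. exact: (mkq_int 2). Qed.
Lemma re1 : re 1 = 1. Proof. by rewrite mkq1 re_mkq. Qed.
Lemma im1 : im 1 = 0. Proof. by rewrite mkq1 im_mkq. Qed.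

Lemma mkq_sqrt : mkq 0 1 = s. Proof. by rewrite /mkq scale0r add0r scale1r. Qed.
Lemma re_sqrt : re s = 0. Proof. by rewrite -[X in re X]mkq_sqrt re_mkq. Qed.
Lemma im_sqrt : im s = 1. Proof. by rewrite -[X in im X]mkq_sqrt im_mkq. Qed.

Lemma mul_sqrt y : s * y = mkq (dQ * im y) (re y).
Proof.
rewrite [LHS]mkq_eta reM imM re_sqrt im_sqrt.
by congr mkq; ring.
Qed.

(** Galois conjugation. *)
Definition cj (x : K) : K := mkq (re x) (- im x).

Lemma cj_linear : linear cj.
Proof.
move=> a x y; rewrite /cj mkqZ mkqD /re /im !linearP.
by congr mkq; rewrite opprD -mulrN.
Qed.
HB.instance Definition _ := GRing.isSemilinear.Build rat _ _ _ cj
  (GRing.semilinear_linear cj_linear).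

Lemma cjK : involutive cj.
Proof. by move=> x; rewrite /cj re_mkq im_mkq opprK -mkq_eta. Qed.

Lemma field_trace_linear (a : rat) (x y : K) :
  field_trace (a *: x + y) = a * field_trace x + field_trace y.
Proof. by rewrite /field_trace 2!linearP mxtraceD mxtraceZ. Qed.

Lemma field_trace1 : field_trace (1 : K) = 2.
Proof.
rewrite /field_trace amull1 mxof1 ?(basis_free (vbasisP _)) //.
by rewrite mxtrace1 -qbasis_full (eqP qbasis_free).
Qed.

(** Conjugation anticommutes with multiplication by s and is an involution, so
    the matrix of multiplication by s is similar to its opposite. *)
Lemma field_trace_sqrt : field_trace s = 0.
Proof.
set e := vbasis {:K}; pose S := mxof e e (linfun cj).
have eB : basis_of {:K} e := vbasisP _.
have SS : S *m S = 1%:M.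
  rewrite -mxof_comp // -(mxof1 (basis_free eB)); congr mxof.
  by apply/lfunP=> x; rewrite comp_lfunE !lfunE /= cjK.
pose M := mxof e e (amull s).
have SM : S *m M = - (M *m S).
  rewrite -!mxof_comp // -raddfN; congr mxof.
  apply/lfunP=> x; rewrite opp_lfunE !comp_lfunE !lfunE /=.
  rewrite !mul_sqrt /cj !re_mkq !im_mkq mkqN.
  by congr mkq; ring.
have : \tr M = - \tr M.
  rewrite -{1}[M]mul1mx -SS -mulmxA mxtrace_mulC SM mulNmx -mulmxA SS.
  by rewrite mulmx1 raddfN.
rewrite -/(field_trace s) /field_trace -/M; lra.
Qed.

Lemma field_traceE x : field_trace x = 2 * re x.
Proof.
rewrite {1}[x]mkq_eta /mkq field_trace_linear field_trace1.
have := field_trace_linear (im x - 1) s s.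
rewrite -[X in _ *: _ + X]scale1r -scalerDl subrK => ->.
by rewrite field_trace_sqrt mulr0 !addr0 mulrC.
Qed.

(** * The ring of integers of a quadratic field *)

Lemma cj_mkq a b : cj (mkq a b) = mkq a (- b).
Proof. by rewrite /cj re_mkq im_mkq. Qed.

Lemma cjM x y : cj (x * y) = cj x * cj y.
Proof. by rewrite /cj reM imM mkqM; congr mkq; ring. Qed.

Lemma integral_cj x : ring_of_integers K x -> ring_of_integers K (cj x).
Proof.
case=> p mon_p px0; exists p => //; move: px0; rewrite /root.
suff -> : (map_poly intr p).[cj x] = cj (map_poly intr p).[x].
  by move/eqP->; rewrite linear0.
elim/poly_ind: p {mon_p} => [|p c IHp].
  by rewrite map_poly0 !horner0 linear0.
rewrite rmorphD rmorphM /= map_polyX map_polyC /= !hornerMXaddC IHp.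
rewrite [RHS]linearD /= cjM.
by rewrite [c%:~R]mkq_int cj_mkq oppr0.
Qed.

(** The two quantities are the trace x + cj x and the norm x * cj x: they are
    integral when x is, and they are the coefficients of a monic polynomial
    of degree 2 with root x. *)
Lemma ring_of_integersP x :
  ring_of_integers K x <->
  2 * re x \is a Num.int /\ re x ^+ 2 - dQ * im x ^+ 2 \is a Num.int.
Proof.
split=> [Ox | [/intrP[m xm] /intrP[n xn]]].
  have Ocx := integral_cj Ox.
  split; apply: (@integral_rat_int K); rewrite mkq_rat.
    have -> : mkq (2 * re x) 0 = x + cj x.
      by rewrite {2}[x]mkq_eta mkqD; congr mkq; ring.
    exact: integral_add.
  have -> : mkq (re x ^+ 2 - dQ * im x ^+ 2) 0 = x * cj x.
    by rewrite {3}[x]mkq_eta mkqM; congr mkq; ring.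
  exact: integral_mul.
exists (('X - m%:P) * 'X + n%:P).
  rewrite monicE lead_coefDl ?lead_coefMX ?lead_coefXsubC //.
  by rewrite size_mulX ?polyXsubC_eq0 // size_XsubC size_polyC; case: eqP.
rewrite /root rmorphD rmorphM rmorphB /= map_polyX !map_polyC /= hornerMXaddC.
rewrite !hornerE [x]mkq_eta !mkq_int mkqN mkqD mkqM mkqD -xm -xn.
by apply/eqP; rewrite -[RHS]mkq0; congr mkq; ring.
Qed.

(** Integrality of the trace and of the norm makes d (2 im x) ^ 2 an integer, so
    2 im x is an integer because d is square-free. *)
Lemma integral_half_coords x : ring_of_integers K x ->
  exists m k n : int, [/\ x = mkq (m%:~R / 2) (k%:~R / 2)
                        & m ^+ 2 - d%:Z * k ^+ 2 = 4 * n].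
Proof.
case/ring_of_integersP => /intrP[m xm] /intrP[n xn].
have /intrP[k xk] : 2 * im x \is a Num.int.
  apply: (squarefree_rat_int hd).
  have -> : d%:R * (2 * im x) ^+ 2 = (m ^+ 2 - 4 * n)%:~R.
    rewrite rmorphB rmorphXn rmorphM /= -xm -xn -/dQ; ring.
  exact: rpred_int.
exists m, k, n; split; first by rewrite -xm -xk {1}[x]mkq_eta; congr mkq; field.
apply: (@intr_inj rat); rewrite rmorphB rmorphXn [X in _ - X]rmorphM.
rewrite [RHS]rmorphM rmorphXn /= -xm -xk -xn.
by rewrite -pmulrn -/dQ; ring.
Qed.

(** A uniform description of the modular lattice for all classes of d mod 4:
    half-integral coordinates m / 2 and k / 2 with m + d k even. *)
Definition half_lattice : set K :=
  [set x | 2 * im x \is a Num.int /\ re x + dQ * im x \is a Num.int].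

(** When d = 1 mod 4, the integers m and k are subject to m ^ 2 - k ^ 2 being
    divisible by 4, that is, to having the same parity. *)
Lemma ring_of_integers_1mod4 :
  d = 1 %[mod 4] -> ring_of_integers K = half_lattice.
Proof.
move=> d1; pose q : int := (d %/ 4)%N.
have dE : d%:Z = 4 * q + 1 by rewrite /q; lia.
have dQE : dQ = 4 * q%:~R + 1 by rewrite /dQ [d%:R]pmulrn dE rmorphD rmorphM.
apply/seteqP; split=> x /=; last first.
  case=> /intrP[k xk] /intrP[t xt]; apply/ring_of_integersP.
  have -> : im x = k%:~R / 2 by rewrite -xk; field.
  have -> : re x = t%:~R - dQ * (k%:~R / 2) by rewrite -xk -xt; field.
  rewrite dQE; split; apply/intrP.
    by exists (2 * t - (4 * q + 1) * k); field.
  by exists (t ^+ 2 - t * (4 * q + 1) * k + (4 * q + 1) * q * k ^+ 2); field.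
move=> /integral_half_coords [m [k [n [-> mk]]]].
rewrite /half_lattice /= re_mkq im_mkq.
have [t mt] : exists t, m = 2 * t - k.
  have [[a ma] [b kb]] := (int_parity m, int_parity k).
  (* The last term adds 1 when m, hence k, is odd. *)
  exists (a + b + (m != 2 * a)).
  by move: mk; rewrite dE; case: ma kb => -> [] ->; lia.
split; apply/intrP; first by exists k; field.
by exists (t + 2 * q * k); rewrite dQE mt; field.
Qed.

(** Here m ^ 2 = d k ^ 2 mod 4 forces m and k to be even. *)
Lemma ring_of_integers_23mod4 x :
  d = 2 %[mod 4] \/ d = 3 %[mod 4] ->
  ring_of_integers K x <-> exists m k : int, x = mkq m%:~R k%:~R.
Proof.
move=> d23; split=> [|[m [k ->]]]; last first.
  apply/ring_of_integersP; rewrite re_mkq im_mkq; split; apply/intrP.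
    by exists (2 * m); field.
  exists (m ^+ 2 - d%:Z * k ^+ 2).
  by rewrite rmorphB [X in _ = _ - X]rmorphM !rmorphXn /= -pmulrn.
move=> /integral_half_coords [m [k [n [-> mk]]]].
pose q : int := (d %/ 4)%N.
have dE : d%:Z = 4 * q + 2 \/ d%:Z = 4 * q + 3 by rewrite /q; lia.
have [a [b [-> ->]]] : exists a b, m = 2 * a /\ k = 2 * b.
  have [[a ma] [b kb]] := (int_parity m, int_parity k).
  by exists a, b; move: mk; case: dE ma kb => -> [] -> [] ->; lia.
by exists a, b; congr mkq; field.
Qed.

(** * The modular lattice of level d *)

Lemma dQ_neq0 : dQ != 0.
Proof. by rewrite pnatr_eq0 -lt0n; apply: ltn_trans hd1. Qed.

Lemma lattice_form1 x y : lattice_form 1 x y = 2 * re (x * y).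
Proof. by rewrite /lattice_form mul1r field_traceE. Qed.

(** Dividing by s turns the trace form into twice the s-coordinate of a
    product, which is an integer on the lattice. Conversely the test vectors
    1 and (d + s) / 2 of the lattice recover its two defining conditions. *)
Lemma half_lattice_modular :
  half_lattice = [set s * x | x in dual_ideal half_lattice 1].
Proof.
have imE z x : im (s * x * z) = re (x * z).
  by rewrite -mulrA mul_sqrt im_mkq.
apply/seteqP; split=> [x Lx | _ /= [x dx <-]] /=.
  exists (s^-1 * x); last by rewrite mulVKf ?sqrt_neq0.
  move=> y Ly; rewrite lattice_form1 -imE mulVKf ?sqrt_neq0 // imM.
  case: Lx Ly => /intrP[k xk] /intrP[m xm] [/intrP[k' yk] /intrP[m' ym]].
  apply/intrP; exists (m * k' + k * m' - d%:Z * k * k').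
  rewrite rmorphB rmorphD !rmorphM /= -xk -xm -yk -ym -pmulrn -/dQ; ring.
have L1 : half_lattice 1.
  by rewrite /half_lattice /= re1 im1 !mulr0 addr0 rpred0 rpred1.
have Lh : half_lattice (mkq (dQ / 2) (1 / 2)).
  rewrite /half_lattice /= re_mkq im_mkq; split; apply/intrP.
    by exists 1; field.
  by exists d%:Z; rewrite -pmulrn -/dQ; field.
have := dx _ L1; have := dx _ Lh; rewrite !lattice_form1 -!imE.
move: (s * x) => z; rewrite !imM re1 im1 re_mkq im_mkq => Ih I1; split.
  by move: I1; congr (_ \is a Num.int); ring.
by move: Ih; congr (_ \is a Num.int); field.
Qed.

Lemma half_lattice_arakelov (R : realType) :
  fractional_ideal half_lattice -> arakelov_modular R d half_lattice 1.
Proof.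
move=> fracL; split; last first.
  by exists s; split; rewrite ?sqrt_neq0 ?hs //; apply: half_lattice_modular.
by split=> //; split=> [|sigma]; rewrite ?oner_neq0 // rmorph1 ltr01.
Qed.

(** * Trace lattices are not self-dual *)

Lemma int_multiple_integral (z : K) :
  exists2 D : int, D != 0 & ring_of_integers K (D%:~R * z).
Proof.
exists (denq (re z) * denq (im z)); first by rewrite mulf_neq0 ?denq_neq0.
have dr0 : (denq (re z))%:~R != 0 :> rat by rewrite intr_eq0 denq_neq0.
have di0 : (denq (im z))%:~R != 0 :> rat by rewrite intr_eq0 denq_neq0.
have rE : re z = (numq (re z))%:~R / (denq (re z))%:~R by rewrite divq_num_den.
have iE : im z = (numq (im z))%:~R / (denq (im z))%:~R by rewrite divq_num_den.
apply/ring_of_integersP; rewrite mkq_int reM imM re_mkq im_mkq rmorphM /=.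
set nr := numq (re z) in rE; set ni := numq (im z) in iE.
split; apply/intrP.
  by exists (2 * nr * denq (im z)); rewrite !rmorphM /= {2}rE; field.
exists ((nr * denq (im z)) ^+ 2 - d%:Z * (ni * denq (re z)) ^+ 2).
rewrite rmorphB [X in _ = _ - X]rmorphM !rmorphXn !rmorphM /= -pmulrn -/dQ.
by rewrite {2}rE {4}iE; field; apply/andP.
Qed.

(** Up to an integer, it is the norm of a nonzero element. *)
Lemma submodule_rat_neq0 (I : set K) :
  OK_submodule I -> (exists2 x, I x & x != 0) ->
  exists2 a : rat, a != 0 & I a%:A.
Proof.
case=> _ _ IM [x Ix x0]; have [D D0 OD] := int_multiple_integral (cj x).
have cjx0 : cj x != 0.
  by apply: contra_neq x0 => cx0; rewrite -[x]cjK cx0 linear0.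
have xE : D%:~R * cj x * x = (D%:~R * (re x ^+ 2 - dQ * im x ^+ 2))%:A.
  rewrite mkq_rat mkq_int {2}[x]mkq_eta /cj !mkqM; congr mkq; ring.
exists (D%:~R * (re x ^+ 2 - dQ * im x ^+ 2)); last by rewrite -xE; apply: IM.
have : D%:~R * cj x * x != 0.
  rewrite !mulf_neq0 // -[D%:~R](rmorph_int (in_alg K)) fmorph_eq0.
  by rewrite intr_eq0.
by apply: contra_neq; rewrite xE => ->; rewrite scale0r.
Qed.

(** The trace form is integral on I and I contains a nonzero rational number, so
    the rational numbers in I and the s-coordinates of I are subgroups of the
    rationals with bounded denominators, hence cyclic. A generator of the
    former and an element lifting a generator of the latter form a triangular
    basis of I. *)
Lemma triangular_basis (I : set K) :
  OK_submodule I -> (exists2 x, I x & x != 0) ->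
  (forall x y, I x -> I y -> 2 * re (x * y) \is a Num.int) ->
  exists (a : rat) (e : K), [/\ a != 0, im e != 0, I a%:A, I e &
    forall x, I x -> exists k j : int,
      re x = k%:~R * re e + j%:~R * a /\ im x = k%:~R * im e].
Proof.
move=> subI nzI pairI; have [_ ID IM] := subI.
have Os : ring_of_integers K s.
  apply/ring_of_integersP; rewrite re_sqrt im_sqrt mulr0 expr0n expr1n mulr1.
  by rewrite sub0r rpredN rpred0 rpred_nat.
have IB x y : I x -> I y -> I (x - y).
  move=> Ix Iy; apply: ID => //; rewrite -mulN1r; apply: IM => //.
  by apply: integral_opp; apply: integral1.
have IZ (k : int) x : I x -> I (k%:~R * x).
  by move=> Ix; apply: IM => //; apply: (integral_id (intr : int -> K)).
have [a0 a00 Ia0] := submodule_rat_neq0 subI nzI.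
have [a [a_0 Ia genI]] : exists a, [/\ a != 0, I a%:A &
    forall x, I x%:A -> exists k : int, x = k%:~R * a].
  apply: (@cyclic_rat_subgroup (fun u => I u%:A) (2 * a0) a0) => //.
  - by move=> x y Ix Iy; rewrite scalerBl; apply: IB.
  - move=> x Ix; have := pairI _ _ Ia0 Ix.
    by rewrite !mkq_rat mkqM re_mkq mulr0 addr0 mulrA.
  by rewrite mulf_neq0.
pose imI y := exists2 x, I x & im x = y.
have [c [c_0 [e Ie eC] genIm]] : exists c, [/\ c != 0, imI c &
    forall y, imI y -> exists k : int, y = k%:~R * c].
  apply: (@cyclic_rat_subgroup imI (2 * dQ * a0) a0) => //.
  - move=> _ _ [x Ix <-] [y Iy <-]; exists (x - y); first exact: IB.
    by rewrite /im linearB.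
  - move=> _ [x Ix <-]; have := pairI _ _ (IM _ _ Os Ia0) Ix.
    rewrite mkq_rat mul_sqrt re_mkq im_mkq reM re_mkq im_mkq.
    by congr (_ \is a Num.int); ring.
  - by rewrite !mulf_neq0 // dQ_neq0.
  - exists (s * a0%:A); first exact: IM.
    by rewrite mkq_rat mul_sqrt im_mkq re_mkq.
exists a, e; rewrite eC; split=> // x Ix.
have [k xk] : exists k : int, im x = k%:~R * c by apply: genIm; exists x.
have [j uj] : exists j : int, re x - k%:~R * re e = j%:~R * a.
  apply: genI; rewrite mkq_rat.
  have -> : mkq (re x - k%:~R * re e) 0 = x - k%:~R * e.
    rewrite {2}[x]mkq_eta {2}[e]mkq_eta mkq_int mkqM mkqN mkqD xk eC.
    by congr mkq; ring.
  exact/IB/IZ.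
by exists k, j; split; [rewrite -uj; ring | exact: xk].
Qed.

(** For the triangular basis (a, e) of a self-dual I, the Gram matrix is
    integral and so is its inverse, which expresses the dual basis in the
    basis (a, e). Its determinant 4 d (a c) ^ 2, where c is the s-coordinate
    of e, is therefore 1, and d is a rational square. *)
Lemma not_self_dual (I : set K) :
  OK_submodule I -> (exists2 x, I x & x != 0) -> I = dual_ideal I 1 -> False.
Proof.
move=> subI nzI selfI.
have pairI x y : I x -> I y -> 2 * re (x * y) \is a Num.int.
  by rewrite {1}selfI => dx Iy; rewrite -lattice_form1; apply: dx.
have [a [e [a_0 c_0 Ia Ie spanI]]] := triangular_basis subI nzI pairI.
have dualI f : 2 * re (f * a%:A) \is a Num.int ->
    2 * re (f * e) \is a Num.int -> I f.
  move=> fa fe; rewrite selfI => x /spanI[k [j [rx ix]]]; rewrite lattice_form1.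
  have -> : 2 * re (f * x) =
      k%:~R * (2 * re (f * e)) + j%:~R * (2 * re (f * a%:A)).
    by rewrite mkq_rat !reM re_mkq im_mkq rx ix; ring.
  by rewrite rpredD // rpredM ?rpred_int.
set b := re e in spanI *; set c := im e in c_0 spanI *.
have dQ0 := dQ_neq0.
(* The next two elements of K form the basis dual to (a, e). *)
have /spanI[p [q []]] : I (mkq (1 / (2 * a)) (- b / (2 * a * dQ * c))).
  apply: dualI; rewrite ?mkq_rat reM !re_mkq !im_mkq.
    by rewrite [X in X \is a _](_ : _ = 1) ?rpred1 //; field; apply/and3P.
  by rewrite -/b -/c [X in X \is a _](_ : _ = 0) ?rpred0 //; field; apply/and3P.
rewrite re_mkq im_mkq => f1r f1i.
have /spanI[r [t []]] : I (mkq 0 (1 / (2 * dQ * c))).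
  apply: dualI; rewrite ?mkq_rat reM !re_mkq !im_mkq.
    by rewrite mulr0 mul0r addr0 mulr0 rpred0.
  by rewrite -/c [X in X \is a _](_ : _ = 1) ?rpred1 //; field; apply/andP.
rewrite re_mkq im_mkq => f2r f2i.
have /intrP[g11 G11] := pairI _ _ Ia Ia.
have /intrP[g12 G12] := pairI _ _ Ia Ie.
have /intrP[g22 G22] := pairI _ _ Ie Ie.
have detG : 4 * dQ * a ^+ 2 * c ^+ 2 = (g11 * g22 - g12 ^+ 2)%:~R.
  rewrite rmorphB rmorphM rmorphXn /= -G11 -G12 -G22 mkq_rat !reM.
  rewrite re_mkq im_mkq -/b -/c; ring.
have detP : (q * r - t * p)%:~R * (4 * dQ * a ^+ 2 * c ^+ 2) = 1.
  have -> : (q * r - t * p)%:~R = ((p%:~R * b + q%:~R * a) * (r%:~R * c) -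
      (r%:~R * b + t%:~R * a) * (p%:~R * c)) / (a * c).
    by rewrite rmorphB !rmorphM /=; field; apply/andP.
  by rewrite -f1r -f1i -f2r -f2i; field; apply/and3P.
have det_unit : (q * r - t * p) * (g11 * g22 - g12 ^+ 2) = 1.
  by apply: (@intr_inj rat); rewrite rmorphM /= -detG detP.
have det_gt0 : 0 < g11 * g22 - g12 ^+ 2.
  have d0 : 0 < dQ by rewrite ltr0n ltnW.
  rewrite -(ltr0z rat) -detG.
  by do 2?[apply: mulr_gt0; last by rewrite exprn_even_gt0]; apply: mulr_gt0.
have det1 : g11 * g22 - g12 ^+ 2 = 1.
  move: det_gt0 (congr1 absz det_unit); rewrite abszM.
  case: (g11 * g22 - _) => // n _ /eqP.
  by rewrite muln_eq1 => /andP[_ /eqP /= ->].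
have : dQ = 1%:R * (1 / (2 * a * c)) ^+ 2.
  have : 4 * dQ * a ^+ 2 * c ^+ 2 = 1 by rewrite detG det1.
  move=> h; rewrite [RHS]mul1r; apply: (@mulfI _ (4 * a ^+ 2 * c ^+ 2)).
    by rewrite !mulf_neq0 ?expf_neq0.
  rewrite (_ : _ * (1 / (2 * a * c)) ^+ 2 = 1); last by field; apply/andP.
  by rewrite -[RHS]h; ring.
move/(squarefree_ratsq_eq hd squarefree1) => d1.
by move: hd1; rewrite d1.
Qed.

(** * The prime above 2 when d = 2 or 3 mod 4 *)

(** The kernel of the morphism from Z[s] to the field with two elements that
    sends s to d. *)
Definition prime_two : set K :=
  [set x | exists m k j : int, x = mkq m%:~R k%:~R /\ m + d%:Z * k = 2 * j].

(** This is what makes d mod 2 a square root of d mod 2. *)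
Lemma half_pronic : exists t : int, d%:Z * d%:Z = d%:Z + 2 * t.
Proof.
have [a [->|->]] := int_parity d%:Z; first by exists (2 * a ^+ 2 - a); ring.
by exists (2 * a ^+ 2 + a); ring.
Qed.

Lemma mkqM_int (m k m' k' : int) : mkq m%:~R k%:~R * mkq m'%:~R k'%:~R =
  mkq (m * m' + d%:Z * k * k')%:~R (m * k' + k * m')%:~R.
Proof. by rewrite mkqM !rmorphD !rmorphM /= -pmulrn. Qed.

Lemma mkq_int_inj (m k m' k' : int) :
  mkq m%:~R k%:~R = mkq m'%:~R k'%:~R -> m = m' /\ k = k'.
Proof.
move=> eqx; split; apply: (@intr_inj rat).
  by rewrite -[LHS](re_mkq _ k%:~R) eqx re_mkq.
by rewrite -[LHS](im_mkq m%:~R) eqx im_mkq.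
Qed.

Section Ramified.

Hypothesis d23 : d = 2 %[mod 4] \/ d = 3 %[mod 4].

Lemma prime_two_sub : prime_two `<=` ring_of_integers K.
Proof.
move=> x [m [k [j [-> _]]]].
by apply/ring_of_integers_23mod4 => //; exists m, k.
Qed.

Lemma prime_two_OK_submodule : OK_submodule prime_two.
Proof.
split; first by exists 0, 0, 0; rewrite mkq0 !mulr0.
  move=> _ _ [m [k [j [-> mk]]]] [m' [k' [j' [-> mk']]]].
  exists (m + m'), (k + k'), (j + j'); rewrite mkqD !rmorphD; split=> //; lia.
move=> a _ /(ring_of_integers_23mod4 _ d23) [m [k ->]] [m' [k' [j [-> mk']]]].
have [t dd] := half_pronic; rewrite mkqM_int.
exists (m * m' + d%:Z * k * k'), (m * k' + k * m').
exists ((m + d%:Z * k) * j - t * k * k').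
split=> //; have -> : m' = 2 * j - d%:Z * k' by rewrite -mk'; ring.
have /= := congr1 (fun z => z * (k * k')) dd; lia.
Qed.

Lemma prime_two_int (n : int) : prime_two n%:~R <-> (2 %| n)%Z.
Proof.
rewrite mkq_int -[X in mkq _ X](rmorph0 (intr : int -> rat)).
split=> [[m [k [j [/mkq_int_inj[<- <-]]]]]|/dvdzP[j ->]].
  by rewrite mulr0 addr0 => ->; rewrite dvdz_mulr.
by exists (j * 2), 0, j; rewrite mulr0 addr0 mulrC.
Qed.

Lemma prime_two_prime : prime_ideal prime_two.
Proof.
split; [exact: prime_two_sub | exact: prime_two_OK_submodule | |].
  by rewrite -[1]/(1%:~R) prime_two_int.
move=> x y /(ring_of_integers_23mod4 _ d23) [m [k ->{x}]].
move=> /(ring_of_integers_23mod4 _ d23) [m' [k' ->{y}]].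
rewrite mkqM_int => -[a [b [j [/mkq_int_inj[<- <-] abj]]]].
have [t dd] := half_pronic.
have phiM : (m + d%:Z * k) * (m' + d%:Z * k') = 2 * (j + t * k * k').
  have /= := congr1 (fun z => z * (k * k')) dd; lia.
have [u [mu|mu]] := int_parity (m + d%:Z * k); first by left; exists m, k, u.
have [v [mv|mv]] := int_parity (m' + d%:Z * k').
  by right; exists m', k', v.
by move: phiM; rewrite mu mv; lia.
Qed.

(** The square of an element of prime_two is divisible by 2, so prime_two lies
    in each prime Q above 2. If x in Q were outside prime_two, then 1 - x would
    be in prime_two, hence in Q, and Q would contain 1. *)
Lemma prime_two_unique : unique (prime_lying_above 2) prime_two.
Proof.
split; first by split; [exact: prime_two_prime | exact: prime_two_int].
move=> Q [[QO [Q0 QD QM] Q1 Qprime] Qint].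
have Q2 : Q 2 by apply/(Qint 2).
have PQ : prime_two `<=` Q.
  move=> x Px; have Ox := prime_two_sub Px; case: Px => m [k [j [xE mk]]].
  have [t dd] := half_pronic.
  have : Q (x * x).
    rewrite xE mkqM_int.
    have -> : m * m + d%:Z * k * k =
        2 * (2 * j ^+ 2 - 2 * d%:Z * k * j + d%:Z * k ^+ 2 + t * k ^+ 2).
      have -> : m = 2 * j - d%:Z * k by rewrite -mk; ring.
      have /= := congr1 (fun z => z * k ^+ 2) dd; lia.
    have -> : m * k + k * m = 2 * (m * k) by ring.
    set u := (X in 2 * X).
    have -> : mkq (2 * u)%:~R (2 * (m * k))%:~R = mkq u%:~R (m * k)%:~R * 2.
      by rewrite mkq2 mkqM !rmorphM; congr mkq; ring.
    by apply: QM => //; apply/ring_of_integers_23mod4 => //; exists u, (m * k).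
  by case/(Qprime _ _ Ox Ox).
apply/seteqP; split=> // x Qx.
have /(ring_of_integers_23mod4 _ d23) [m [k xE]] := QO _ Qx.
have [u [mk|mk]] := int_parity (m + d%:Z * k); first by exists m, k, u.
case: Q1; rewrite -(subrK x 1); apply: QD => //; apply: PQ.
exists (1 - m), (- k), (- u); split; last by lia.
by rewrite xE mkq1 mkqN mkqD rmorphB rmorphN /= add0r.
Qed.

(** The ideal prime_two is generated by 2 and d + s, and testing against these
    two elements yields the two conditions that define half_lattice. *)
Lemma prime_two_inv : ideal_inv prime_two = half_lattice.
Proof.
have [t dd] := half_pronic.
have dQQ : dQ * dQ = dQ + 2 * t%:~R.
  by rewrite /dQ [d%:R]pmulrn -rmorphM dd rmorphD rmorphM.
apply/seteqP; split=> x.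
  move=> xP; have P2 : prime_two 2 by apply/(prime_two_int 2).
  have Pd : prime_two (mkq d%:Z%:~R 1%:~R).
    by exists d%:Z, 1, d%:Z; split=> //; ring.
  have /(ring_of_integers_23mod4 _ d23)[m [k /(congr1 im)]] := xP _ P2.
  rewrite mkq2 imM !im_mkq re_mkq => x2.
  have /(ring_of_integers_23mod4 _ d23)[m' [k' /(congr1 im)]] := xP _ Pd.
  rewrite imM !im_mkq re_mkq => xd; split; apply/intrP.
    by exists k; rewrite -x2; ring.
  by exists k'; rewrite -xd -pmulrn -/dQ; ring.
case=> /intrP[k xk] /intrP[u xu] _ [m' [k' [j [-> mk]]]].
have m'E : m' = 2 * j - d%:Z * k' by rewrite -mk; ring.
have xim : im x = k%:~R / 2 by rewrite -xk; field.
have xre : re x = u%:~R - dQ * (k%:~R / 2) by rewrite -xu xim; ring.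
apply/ring_of_integers_23mod4 => //.
exists (u * m' - d%:Z * k * j + (d%:Z + t) * k * k').
exists (u * k' + k * j - d%:Z * k * k').
rewrite [LHS]mkq_eta reM imM re_mkq im_mkq xre xim m'E.
by rewrite !(rmorphB, rmorphD, rmorphM) /= -!pmulrn -/dQ; congr mkq; field: dQQ.
Qed.

Lemma prime_two_inv_fractional : fractional_ideal (ideal_inv prime_two).
Proof.
apply: (@fractional_ideal_inv _ _ 2); first exact: prime_two_sub.
  exact/(prime_two_int 2).
by rewrite -[2](rmorph_nat (in_alg K)) fmorph_eq0.
Qed.

End Ramified.

(** * Levels of trace type lattices *)

(** The s-coordinate of b ^ 2 is twice the product of the coordinates of b, so
    one of these vanishes. *)
Lemma level_eq (l : nat) (b : K) : squarefree l -> l%:R = b ^+ 2 ->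
  l = d \/ b = 1 \/ b = -1.
Proof.
move=> sql lb.
have lE : mkq l%:R 0 = b * b by rewrite -expr2 -lb -mkq_rat -in_algE rmorph_nat.
have lre : l%:R = re b ^+ 2 + dQ * im b ^+ 2.
  by rewrite -[LHS](re_mkq _ 0) lE reM; ring.
have : 2 * re b * im b = 0 by rewrite -(im_mkq l%:R 0) lE imM; ring.
move/eqP; rewrite -mulrA !mulf_eq0 /= => /orP[/eqP r0|/eqP i0].
  left; apply: (squarefree_ratsq_eq sql hd (q := im b)).
  by rewrite lre r0 expr0n add0r.
right; have l1 : l = 1%N.
  apply: (squarefree_ratsq_eq sql squarefree1 (q := re b)).
  by rewrite lre i0 mul1r expr0n mulr0 addr0.
have : b ^+ 2 = 1 by rewrite -lb l1.
by move/eqP; rewrite sqrf_eq1 => /orP[] /eqP; [left | right].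
Qed.

Lemma arakelov_level (R : realType) (l : nat) (I : set K) :
  squarefree l -> arakelov_modular R l I 1 -> l = d.
Proof.
move=> sql [[[subI nzI _] _] [b [_ Ib lb]]].
case: (level_eq sql lb) => // b1; case: (not_self_dual subI nzI).
have dualN x : dual_ideal I 1 x -> dual_ideal I 1 (- x).
  move=> dx y Iy; rewrite lattice_form1 mulNr /re linearN mulrN rpredN.
  by rewrite -/(re _) -lattice_form1; apply: dx.
rewrite {1}Ib; apply/seteqP; case: b1 => ->; split=> x /=.
- by case=> y dy <-; rewrite mul1r.
- by move=> dx; exists x; rewrite ?mul1r.
- by case=> y dy <-; rewrite mulN1r; apply: dualN.
- by move=> dx; exists (- x); [apply: dualN | rewrite mulN1r opprK].
Qed.

End QuadraticField.

Theorem proposition4p3 (R : realType) (d : nat) (K : fieldExtType rat)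
    (sqrtd : K) (l : nat)
    (hd1 : (1 < d)%N) (hd : squarefree d)
    (hsqrtd : sqrtd ^+ 2 = d%:R) (hK : <<1; sqrtd>>%VS = {:K}%VS)
    (hl0 : (0 < l)%N) (hl : squarefree l) :
  ((exists (I : set K) (a : K), arakelov_modular R l I a /\ trace_type a)
     <-> l = d)
  /\
  (((d = 2 %[mod 4]) \/ (d = 3 %[mod 4]) ->
      exists P2 : set K, unique (prime_lying_above 2) P2 /\
        arakelov_modular R d (ideal_inv P2) 1)
   /\
   (d = 1 %[mod 4] -> arakelov_modular R d (ring_of_integers K) 1)).
Proof.
have mod23 : d = 2 %[mod 4] \/ d = 3 %[mod 4] ->
    exists P2 : set K, unique (prime_lying_above 2) P2 /\
      arakelov_modular R d (ideal_inv P2) 1.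
  move=> d23; exists (prime_two d sqrtd); split; first exact: prime_two_unique.
  rewrite prime_two_inv //; apply: half_lattice_arakelov => //.
  by rewrite -prime_two_inv //; apply: prime_two_inv_fractional.
have mod1 : d = 1 %[mod 4] -> arakelov_modular R d (ring_of_integers K) 1.
  move=> d1; rewrite (@ring_of_integers_1mod4 d K sqrtd) //.
  apply: half_lattice_arakelov => //.
  by rewrite -ring_of_integers_1mod4 //; apply: fractional_ideal_ring.
split; last by split.
split=> [[I [a [IR a1]]] | ->].
  by move: IR; rewrite (a1 : a = 1); apply: (@arakelov_level d K sqrtd).
have d0 : ~ d = 0 %[mod 4].
  by move=> d0; have /hd : (2 ^ 2 %| d)%N by rewrite /dvdn; apply/eqP.
have : (d = 2 %[mod 4] \/ d = 3 %[mod 4]) \/ d = 1 %[mod 4] by lia.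
case=> [/mod23[P2 [_ mP]] | /mod1 mO].
  by exists (ideal_inv P2), 1.
by exists (ring_of_integers K), 1.
Qed.
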